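(* For all real numbers $0<m\le M$, the function $p\mapsto C((1-p)\delta_m+p\delta_M)$ is a rational function of $p$ on $[0,1]$.
   Context: $\delta_x$ is the Dirac measure at $x$. For a probability distribution $\nu$ on $\{-\infty\}\cup\mathbb{R}$, let $(X_{i,j})_{0\le i<j}$ be i.i.d. random variables with distribution $\nu$, where $X_{i,j}$ is the weight of the directed edge $(i,j)$ of the complete directed acyclic graph on the non-negative integers. A directed path is a sequence of integers $\pi=(i_1,\dots,i_k)$ with $0\le i_1<\dots<i_k$; its weight is $w_\pi=X_{i_1,i_2}+\dots+X_{i_{k-1},i_k}$. Let $W_n=\max\{w_\pi : \pi=(i_1,\dots,i_k) \text{ a directed path with } i_1=0,\ i_k=n\}$. Then $W_n/n$ converges almost surely to a deterministic constant $C(\nu)\in\mathbb{R}\cup\{\pm\infty\}$, called the time constant for last passage percolation. *)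

(* Defs.v *)
From HB Require Import structures.
From mathcomp Require Import all_boot all_order all_algebra.
From mathcomp Require Import all_classical all_reals all_analysis.
From mathcomp Require Import measurable_realfun.
Import Order.TTheory GRing.Theory Num.Theory.
Import numFieldNormedType.Exports.

Set Implicit Arguments.
Unset Strict Implicit.
Unset Printing Implicit Defensive.

Local Open Scope classical_set_scope.
Local Open Scope ring_scope.

Definition directed_path (i j : nat) (pi : seq nat) : bool :=
  [&& pi != [::], sorted ltn pi, head 0%N pi == i & last 0%N pi == j].

(* [x i j] is the weight of the edge (i, j); only the values with i < j are
   ever used on a directed path. *)
Definition path_weight (R : realType) (x : nat -> nat -> \bar R)
    (pi : seq nat) : \bar R :=
  (\sum_(e <- zip pi (behead pi)) x e.1 e.2)%E.

(* There are finitely many, and at least one, directed paths from 0 to n,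
   so that this supremum is a maximum. *)
Definition last_passage (R : realType) (x : nat -> nat -> \bar R) (n : nat) :
    \bar R :=
  ereal_sup [set path_weight x pi | pi in [set pi | directed_path 0 n pi]].

(* Mutual independence of the family (X i) indexed by the i in D. *)
Definition mutually_independent d d' (T : measurableType d)
    (T' : measurableType d') (R : realType) (P : probability T R)
    (I : choiceType) (D : set I) (X : I -> {RV P >-> T'}) : Prop :=
  forall (s : seq I) (B : I -> set T'),
    uniq s -> (forall i, i \in s -> D i) -> (forall i, measurable (B i)) ->
    P (\big[setI/setT]_(i <- s) (X i @^-1` B i)) =
    (\prod_(i <- s) P (X i @^-1` B i))%E.

Definition iid d d' (T : measurableType d) (T' : measurableType d')
    (R : realType) (P : probability T R) (nu : probability T' R)
    (I : choiceType) (D : set I) (X : I -> {RV P >-> T'}) : Prop :=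
  mutually_independent D X /\
  (forall i (B : set T'), D i -> measurable B -> distribution P (X i) B = nu B).

(* [nu] is meant to be carried by {-oo} U R, i.e. to have no atom at +oo. *)
Definition is_time_constant (R : realType) (nu : probability (\bar R) R)
    (c : \bar R) : Prop :=
  forall (d : measure_display) (T : measurableType d) (P : probability T R)
    (X : nat * nat -> {RV P >-> \bar R}),
    iid nu [set e | (e.1 < e.2)%N] X ->
    {ae P, forall w : T,
      (fun n : nat =>
         (last_passage (fun i j => X (i, j) w) n * (n%:R^-1)%:E)%E)
        @ \oo --> c}.

(* An equation [time_constant nu = c%:E] with c real does entail
   [is_time_constant nu c%:E]: the default value -oo is excluded. *)
Definition time_constant (R : realType) (nu : probability (\bar R) R) : \bar R :=
  xget -oo%E [set c | is_time_constant nu c].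

Section two_point.
Context {R : realType}.
Variables (p : {i01 R}) (m M : R).

Lemma onem_i01_ge0 : 0 <= 1 - p%:num.
Proof. by rewrite subr_ge0. Qed.

Lemma i01_ge0 : 0 <= p%:num.
Proof. by []. Qed.

Definition two_point : set (\bar R) -> \bar R :=
  measure_add (mscale (NngNum onem_i01_ge0) \d_(m%:E))
              (mscale (NngNum i01_ge0) \d_(M%:E)).

HB.instance Definition _ := Measure.on two_point.

Lemma two_pointE (A : set (\bar R)) :
  two_point A = ((1 - p%:num)%:E * \d_(m%:E) A + (p%:num)%:E * \d_(M%:E) A)%E.
Proof. by rewrite /two_point measure_addE. Qed.

Lemma two_point_setT : two_point setT = 1%E.
Proof.
by rewrite two_pointE !diracE !in_setT !mule1 -EFinD subrK.
Qed.

HB.instance Definition _ :=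
  Measure_isProbability.Build _ _ R two_point two_point_setT.
End two_point.

(* Main.v *)
From HB Require Import structures.
Require Import Defs.
From mathcomp Require Import all_boot all_order all_algebra.
From mathcomp Require Import all_classical all_reals all_analysis.
From mathcomp Require Import measurable_realfun.
From mathcomp Require Import zify ring lra.
Import Order.TTheory GRing.Theory Num.Theory.
Import numFieldNormedType.Exports.

(* Let V_n be the weight of the heaviest path from 0 to n. Since all weights
   are at least m > 0, only the vertices i with V_i > V_n - (M - m) can be the
   start of a useful M-edge to n + 1, so the capped gaps min(M - m, V_n - V_i)
   form a Markov chain. Every gap has the form j m or M - j m, so the chain is
   finite, and its transition probabilities are polynomials in p. Solving the
   Poisson equation by Cramer's rule gives V_n = n C + (martingale) + O(1) with
   C rational in p; the determinant vanishes for no p in [0, 1] because a run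
   of all-M columns (if p > 0) or of all-m columns (if p < 1) synchronises the
   chain. The martingale is o(n) almost surely by an exponential moment bound
   and Borel-Cantelli. That the time constant is unique requires at least one
   i.i.d. family to exist: it is read off the p-expansion of a uniform point of
   [0, 1). *)

Set Implicit Arguments.
Unset Strict Implicit.
Unset Printing Implicit Defensive.

Local Open Scope classical_set_scope.
Local Open Scope ring_scope.

(** * The chain of capped gaps *)

Section Recursion.
Context {R : realFieldType} (m M : R) (K : nat).
Hypotheses (m_gt0 : 0 < m) (le_mM : m <= M) (K_large : M - m <= K%:R * m).

(** With [u k] the gap between the heights of the vertices [n] and [n - k], capped at [M - m], and
    [b k] telling whether the edge from [n - k] to [n + 1] weighs [M], this is the growth of the
    height from [n] to [n + 1]. A capped gap contributes only [m], the default of the maximum. *)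
Definition increment (u : nat -> R) (b : 'I_K -> bool) : R :=
  \big[Num.max/m]_(k < K | b k) (M - u k).

Definition shift (u : nat -> R) (b : 'I_K -> bool) (k : nat) : R :=
  if k is k'.+1 then Num.min (M - m) (u k' + increment u b) else 0.

(** Vertices of negative index count as capped, so that edges from them never raise the height by
    more than [m]. *)
Definition gap0 (k : nat) : R := if k is 0 then 0 else M - m.

Fixpoint gaps (b : nat -> 'I_K -> bool) (n : nat) : nat -> R :=
  if n is n'.+1 then shift (gaps b n') (b n') else gap0.

Fixpoint height (b : nat -> 'I_K -> bool) (n : nat) : R :=
  if n is n'.+1 then height b n' + increment (gaps b n') (b n') else 0.

Lemma increment_ge_min u b : m <= increment u b.
Proof. exact: bigmax_ge_id. Qed.

Lemma increment_ge (u : nat -> R) (b : 'I_K -> bool) (k : 'I_K) :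
  b k -> M - u k <= increment u b.
Proof. by move=> bk; apply: (le_bigmax_cond _ (fun k : 'I_K => M - u k)). Qed.

Lemma increment_attained u b :
  increment u b = m \/ exists2 k : 'I_K, b k & increment u b = M - u k.
Proof.
rewrite /increment; elim/big_rec: _ => [|k x bk ih]; first by left.
by case: (leP (M - u k) x) => _; [exact: ih|right; exists k].
Qed.

Section Trajectory.
Variable b : nat -> 'I_K -> bool.
Local Notation V := (height b).
Local Notation u := (gaps b).

Lemma height_step n : m <= V n.+1 - V n.
Proof. by rewrite /= addrAC subrr add0r increment_ge_min. Qed.

Lemma height_growth i n : (i <= n)%N -> (n - i)%:R * m <= V n - V i.
Proof.
elim: n => [|n ih]; first by rewrite leqn0 => /eqP ->; rewrite subrr mul0r.
rewrite leq_eqVlt => /orP[/eqP ->|]; first by rewrite !subrr subnn mul0r.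
rewrite ltnS => lein; rewrite subSn// -natr1 mulrDl mul1r.
by have := ih lein; have := height_step n; lra.
Qed.

Lemma height_mono i n : (i <= n)%N -> V i <= V n.
Proof.
move=> lein; rewrite -subr_ge0; apply: le_trans (height_growth lein).
by rewrite mulr_ge0// ltW.
Qed.

Lemma height_lt i n : V i < V n -> (i < n)%N.
Proof. by rewrite ltnNge; apply: contraL => /height_mono; rewrite leNgt. Qed.

(** Capping commutes with the update because increments are positive: a gap that has reached the cap
    stays there. *)
Lemma gapsE n k :
  u n k = if (k <= n)%N then Num.min (M - m) (V n - V (n - k)%N) else M - m.
Proof.
elim: n k => [|n ih] [|k] //=.
- by rewrite subrr min_r// subr_ge0.
- by rewrite subrr min_r// subr_ge0.
rewrite ih ltnS subSS; case: leqP => kn /=.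
  have := increment_ge_min (u n) (b n); move: (increment _ _) => d dm.
  rewrite addrAC; set x := V n - _; clearbody x.
  by case: (leP (M - m) x) => [?|//]; rewrite !min_l//; move: m_gt0; lra.
rewrite min_l//.
by have := increment_ge_min (u n) (b n); move: m_gt0; lra.
Qed.

(** An increment above [m] can only come from an uncapped gap, hence from an actual vertex. *)
Lemma height_attained n :
  V n.+1 = V n + m \/
  exists i, [/\ (i <= n)%N, V n + m < V n.+1 & V n.+1 = V i + M].
Proof.
have := increment_ge_min (u n) (b n); rewrite le_eqVlt => /orP[/eqP dm|dm].
  by left; rewrite /= -dm.
right; case: (increment_attained (u n) (b n)) => [e|[k bk e]].
  by rewrite e ltxx in dm.
have uk := gapsE n k; move: dm; rewrite e => dm.
case: leqP uk => [kn|_] uk; last by lra.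
have {}uk : u n k = V n - V (n - k)%N.
  by move: uk; case: leP => _ uk; lra.
exists (n - k)%N; rewrite leq_subr /= e uk; split=> //; last by ring.
by rewrite ltrD2l -uk.
Qed.

(* [c n] counts the M-edges of an optimal path to n. An M-edge jumps from V_i
   to V_i + M, and the sources V_i of successive jumps increase; hence c is
   monotone, and grows by at most one over a window of length M. *)
Lemma height_decomposition N : exists a c : nat -> nat,
  forall n, (n <= N)%N ->
    V n = (a n)%:R * m + (c n)%:R * M /\
    forall i, (i <= n)%N ->
      (c i <= c n)%N /\ (V n - V i < M -> (c n <= (c i).+1)%N).
Proof.
have m0 := m_gt0; have mM := le_mM.
elim: N => [|N [a [c ih]]].
  exists (fun _ => 0%N), (fun _ => 0%N) => n; rewrite leqn0 => /eqP ->.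
  by split=> //=; rewrite !mul0r addr0.
suff [a' [c' [VN c'P]]] : exists a' c' : nat,
    V N.+1 = a'%:R * m + c'%:R * M /\
    forall i, (i <= N)%N ->
      (c i <= c')%N /\ (V N.+1 - V i < M -> (c' <= (c i).+1)%N).
  exists (fun n => if n == N.+1 then a' else a n).
  exists (fun n => if n == N.+1 then c' else c n) => n.
  rewrite leq_eqVlt => /orP[/eqP ->|]; rewrite ?eqxx.
    split=> // i; rewrite leq_eqVlt => /orP[/eqP ->|]; first by rewrite eqxx.
    rewrite ltnS => iN; have -> : (i == N.+1) = false by lia.
    exact: c'P.
  rewrite ltnS => nN; have -> : (n == N.+1) = false by lia.
  have [? nP] := ih n nN; split=> // i lein.
  have -> : (i == N.+1) = false by lia.
  exact: nP.
have [VNE NP] := ih N (leqnn N).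
have M_gt0 : 0 < M by exact: lt_le_trans le_mM.
case: (height_attained N) => [VS|[i [iN VS1 VS2]]].
  exists (a N).+1, (c N); split.
    by rewrite VS VNE -natr1; ring.
  move=> i iN; have [? iP] := NP i iN; split=> // h.
  by apply: iP; lra.
exists (a i), (c i).+1; have [ViE iP] := ih i iN; split.
  by rewrite VS2 ViE -natr1; ring.
move=> j jN; split.
  have [cjN _] := NP j jN; apply: (leq_trans cjN).
  by have [_] := NP i iN; apply; lra.
move=> h; rewrite ltnS.
have ij : (i < j)%N by apply: height_lt; lra.
by have [_ jP] := ih j jN; have [] := jP i (ltnW ij).
Qed.

End Trajectory.

(** The two families are the differences of heights that use equally many [M]-edges, or one more at
    the later vertex. In the second, nonnegativity gives [j * m <= M <= K.+1%:R * m], whence the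
    range of [j]. *)
Definition gap_values : seq R :=
  [seq x <- [seq j%:R * m | j <- iota 0 K.+2] ++
            [seq M - j%:R * m | j <- iota 0 K.+2] | 0 <= x <= M - m].

Lemma cap_gap_values : M - m \in gap_values.
Proof.
rewrite mem_filter mem_cat subr_ge0 le_mM lexx; apply/orP; right.
by apply/mapP; exists 1%N; rewrite ?mul1r// mem_iota.
Qed.

Lemma min_gap_values j : Num.min (M - m) (j%:R * m) \in gap_values.
Proof.
have KmM := K_large.
rewrite /Num.min; case: ifPn; first by rewrite cap_gap_values.
rewrite -leNgt => h; rewrite mem_filter mem_cat h mulr_ge0 ?ler0n ?ltW//.
apply/orP; left; apply/mapP; exists j => //.
rewrite mem_iota add0n -addn2.
have : j%:R * m <= K%:R * m by lra.
by rewrite ler_pM2r// ler_nat; lia.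
Qed.

(** An uncapped gap is less than [M], so by [height_decomposition] the counts of [M]-edges at its
    two ends differ by 0 or 1; each case lands in one of the two families. *)
Lemma gaps_gap_values b n k : gaps b n k \in gap_values.
Proof.
have m0 := m_gt0; have mM := le_mM; have KmM := K_large.
rewrite gapsE; case: ifP => [kn|_]; last exact: cap_gap_values.
rewrite /Num.min; case: ifPn; first by rewrite cap_gap_values.
rewrite -leNgt => h; set i := (n - k)%N in h *.
have lein : (i <= n)%N by exact: leq_subr.
have Vin := height_mono b lein.
rewrite mem_filter mem_cat subr_ge0 Vin h andTb.
have [a [c H]] := height_decomposition b n.
have [Vn /(_ i lein)[cin cni]] := H n (leqnn n).
have [Vi _] := H i lein.
have {}cni : (c n <= (c i).+1)%N by apply: cni; lra.
apply/orP; have [e|e] : c n = c i \/ c n = (c i).+1 by lia.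
- left; apply/mapP; exists (a n - a i)%N.
    rewrite mem_iota add0n.
    suff : (a n)%:R <= (a i + K)%:R :> R by rewrite ler_nat; lia.
    rewrite -(ler_pM2r m_gt0) natrD mulrDl; move: h; rewrite Vn Vi e; lra.
  suff ai : (a i <= a n)%N by rewrite natrB// Vn Vi e; ring.
  by rewrite -(ler_nat R) -(ler_pM2r m_gt0); move: Vin; rewrite Vn Vi e; lra.
- right; apply/mapP; exists (a i - a n)%N.
    rewrite mem_iota add0n.
    suff : (a i)%:R <= (a n + K.+1)%:R :> R by rewrite ler_nat; lia.
    rewrite -(ler_pM2r m_gt0) natrD -natr1 !mulrDl.
    by move: Vin; rewrite Vn Vi e -natr1; lra.
  suff ai : (a n <= a i)%N by rewrite natrB// Vn Vi e -natr1; ring.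
  rewrite -(ler_nat R) -(ler_pM2r m_gt0).
  by move: h; rewrite Vn Vi e -natr1; lra.
Qed.
(** Each step raises the height by at least [m], so [K] steps reach the cap; this is why [K]
    coordinates describe a state. *)
Lemma gaps_cap b n k : (K <= k)%N -> gaps b n k = M - m.
Proof.
move=> Kk; rewrite gapsE; case: leqP => // kn; rewrite min_l//.
apply: le_trans (height_growth b (leq_subr k n)).
by rewrite subKn//; apply: le_trans K_large _; rewrite ler_pM2r// ler_nat.
Qed.

(** The extra code [size gap_values], which [index] returns for a missing value, decodes to the cap.
    Unreachable states are included, so synchronisation is proved from every state. *)
Definition state := {ffun 'I_K -> 'I_(size gap_values).+1}.

Definition decode (s : state) (k : nat) : R :=
  if k is 0 then 0 else
  if insub k is Some k' then nth (M - m) gap_values (s k') else M - m.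

Definition encode (v : nat -> R) : state :=
  [ffun k : 'I_K => inord (index (v k) gap_values)].

Definition advance (s : state) (x : {ffun 'I_K -> bool}) : state :=
  encode (shift (decode s) x).

Lemma decode_ge0 s k : 0 <= decode s k.
Proof.
case: k => [|k] //=; case: insubP => [k' _ _|_]; last by rewrite subr_ge0.
have [lt|ge] := ltnP (s k') (size gap_values).
  by have := mem_nth (M - m) lt; rewrite mem_filter => /andP[/andP[]].
by rewrite nth_default// subr_ge0.
Qed.

Lemma encode_ext v v' : (forall k, (k < K)%N -> v k = v' k) ->
  encode v = encode v'.
Proof. by move=> e; apply/ffunP => k; rewrite !ffunE e. Qed.

Lemma decode_encode v k : v 0%N = 0 -> ((k < K)%N -> v k \in gap_values) ->
  ((K <= k)%N -> v k = M - m) -> decode (encode v) k = v k.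
Proof.
case: k => [|k] v0 small large //=; case: insubP => [k' kK kE|].
  by rewrite ffunE kE inordK ?nth_index// ?small// ltnS index_size.
by rewrite -leqNgt => /large ->.
Qed.

Lemma increment_ext v v' x : (forall k, v k = v' k) ->
  increment v x = increment v' x.
Proof. by move=> e; apply: eq_bigr => k _; rewrite e. Qed.

Lemma shift_ext v v' x k : (forall k, v k = v' k) -> shift v x k = shift v' x k.
Proof. by case: k => [|k] e //=; rewrite e (increment_ext _ e). Qed.

(** Encoding loses nothing along a trajectory from [gap0], since its gaps lie in [gap_values] and
    are capped from [K] on; the finite chain therefore computes the true gaps. *)
Lemma decode_foldl (x : nat -> {ffun 'I_K -> bool}) n k :
  decode (foldl advance (encode gap0) (mkseq x n)) k = gaps (fun n => x n) n k.
Proof.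
set y := fun n => x n : 'I_K -> bool; elim: n k => [|n ih] k.
  by apply: decode_encode => // Kk; [exact: (gaps_gap_values y 0 k)
                                    |exact: (gaps_cap y 0 Kk)].
have shiftE : shift (decode (foldl advance (encode gap0) (mkseq x n))) (x n) k =
    gaps y n.+1 k by rewrite (shift_ext _ _ ih).
rewrite mkseqS foldl_rcons decode_encode// shiftE//= => Kk.
  exact: (gaps_gap_values y n.+1 k).
exact: (gaps_cap y n.+1 Kk).
Qed.

(** An [M]-edge from the newest vertex, whose gap is 0, makes the increment at least [M], so every
    older gap jumps to the cap and the chain restarts from [gap0]. *)
Lemma advance_ones s s' :
  (0 < K)%N -> advance s [ffun=> true] = advance s' [ffun=> true].
Proof.
suff ones t k : (0 < K)%N -> shift (decode t) [ffun=> true] k = gap0 k.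
  by move=> K_gt0; apply: encode_ext => k _; rewrite !ones.
move=> K_gt0; case: k => [|k] //=; rewrite min_l//.
have := @increment_ge (decode t) [ffun=> true] (Ordinal K_gt0).
rewrite ffunE /= => /(_ isT); have := decode_ge0 t k; move: m_gt0; lra.
Qed.

Lemma increment_zeros v :
  increment v ([ffun=> false] : {ffun 'I_K -> bool}) = m.
Proof. by rewrite /increment big_pred0// => k; rewrite ffunE. Qed.

(** After more than [k] steps, gap [k] is a sum of increments made since its vertex appeared, all
    equal to [m]; the initial state is forgotten. *)
Lemma iter_advance_zeros s j k : (k < j)%N ->
  decode (iter j (advance^~ [ffun=> false]) s) k = Num.min (M - m) (k%:R * m).
Proof.
elim: j k => [//|j ih] k kj; rewrite iterS.
set t := iter j _ s in ih *.
have tE : shift (decode t) ([ffun=> false] : {ffun 'I_K -> bool}) k =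
    Num.min (M - m) (k%:R * m).
  case: k kj => [|k] kj /=; first by rewrite mul0r min_r// subr_ge0.
  rewrite increment_zeros ih// -natr1 mulrDl mul1r.
  case: (leP (M - m) (k%:R * m)) => [?|//]; rewrite !min_l//; move: m_gt0; lra.
rewrite decode_encode// tE// => [_|Kk]; first exact: min_gap_values.
by rewrite min_l//; apply: le_trans K_large _; rewrite ler_pM2r// ler_nat.
Qed.

(** Distinct states may decode to the same gaps; after [K] steps the gaps agree, and one further
    [advance] re-encodes them into the same state. *)
Lemma iter_advance_zeros_eq s s' :
  iter K.+1 (advance^~ [ffun=> false]) s =
  iter K.+1 (advance^~ [ffun=> false]) s'.
Proof.
rewrite !iterS; apply: encode_ext => -[|k] kK //=.
by rewrite !increment_zeros !iter_advance_zeros// ltnW.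
Qed.

End Recursion.

(** * Last passage values as heights of the chain *)

Section LastPassageHeight.
Context {R : realType} (m M : R) (K : nat).
Hypotheses (m_gt0 : 0 < m) (le_mM : m <= M) (K_large : M - m <= K%:R * m).
Variables (y : nat -> nat -> R) (b : nat -> 'I_K -> bool).
Hypothesis yE : forall i j, (i < j)%N -> y i j = m \/ y i j = M.
Hypothesis bE : forall n (k : 'I_K), (k <= n)%N ->
  b n k = (y (n - k)%N n.+1 == M).
Local Notation V := (height m M b).

(** An [M]-edge of length at most [K] is seen by the column. A longer one is dominated by unit
    steps, which already gain [K%:R * m + m >= M]. *)
Lemma height_edge_le i n : (i < n)%N -> V i + y i n <= V n.
Proof.
have m0 := m_gt0; have mM := le_mM; have KmM := K_large.
case: n => // n; rewrite ltnS => lein; have [->|yM] := @yE i n.+1 lein.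
  have := height_mono M m0 b lein; have := height_step m M b n; lra.
have [ltK|geK] := ltnP (n - i) K.
  have bk : b n (Ordinal ltK) by rewrite bE ?leq_subr//= subKn// yM.
  have := increment_ge m M (gaps m M b n) bk.
  have : gaps m M b n (n - i) <= V n - V i.
    by rewrite (gapsE m0 mM) leq_subr subKn// ge_min lexx orbT.
  rewrite yM /=; lra.
have := height_growth m M b lein; have := height_step m M b n.
have : K%:R * m <= (n - i)%:R * m by rewrite ler_pM2r// ler_nat.
rewrite yM; lra.
Qed.

(** An increment equal to [m] is matched by the edge from [n] to [n + 1], which weighs at least [m];
    a larger one comes from an uncapped gap across an [M]-edge. *)
Lemma height_edge_attained n : exists i, (i <= n)%N /\ V n.+1 <= V i + y i n.+1.
Proof.
have m0 := m_gt0; have mM := le_mM.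
have step : V n.+1 = V n + m -> V n.+1 <= V n + y n n.+1.
  by move=> ->; have [->|->] := @yE n n.+1 (ltnSn n); lra.
have [e|[k bk e]] := increment_attained m M (gaps m M b n) (b n).
  by exists n; split=> //; apply: step; rewrite /= e.
have := gapsE m0 mM b n k; case: leqP => kn gk; last first.
  by exists n; split=> //; apply: step; rewrite /= e gk; ring.
have yM : y (n - k)%N n.+1 = M by apply/eqP; rewrite -bE.
move: gk; case: leP => h gk.
  by exists n; split=> //; apply: step; rewrite /= e gk; ring.
by exists (n - k)%N; rewrite leq_subr /= e gk yM; split=> //; lra.
Qed.

Variables (x : nat -> nat -> \bar R).
Hypothesis xE : forall i j, (i < j)%N -> x i j = (y i j)%:E.

Lemma path_weight_cons i j s :
  path_weight x (i :: j :: s) = (x i j + path_weight x (j :: s))%E.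
Proof. by rewrite /path_weight /= big_cons. Qed.

Lemma path_weight_rcons i s j :
  path_weight x (i :: rcons s j) =
  (path_weight x (i :: s) + x (last i s) j)%E.
Proof.
elim: s i => [|k s ih] i.
  by rewrite /path_weight /= big_seq1 big_nil add0e.
by rewrite rcons_cons !path_weight_cons ih addeA.
Qed.

Lemma path_weight_le i s : path ltn i s ->
  ((V i)%:E + path_weight x (i :: s) <= (V (last i s))%:E)%E.
Proof.
elim: s i => [|j s ih] i /=; first by rewrite /path_weight big_nil adde0.
move=> /andP[ij js]; rewrite path_weight_cons xE// addeA -EFinD.
by apply: le_trans (ih j js); rewrite leeD2r// lee_fin height_edge_le.
Qed.

Lemma path_weight_attained n : exists s,
  [/\ path ltn 0%N s, last 0%N s = n & ((V n)%:E <= path_weight x (0%N :: s))%E].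
Proof.
elim/ltn_ind: n => -[|n] ih.
  by exists [::]; split=> //; rewrite /path_weight big_nil.
have [i [lein Vn]] := height_edge_attained n.
have [s [s_path s_last sV]] := ih i lein.
exists (rcons s n.+1); split.
- by rewrite rcons_path s_path s_last /=.
- by rewrite last_rcons.
rewrite path_weight_rcons s_last xE//; apply: le_trans (leeD2r _ sV).
by rewrite -EFinD lee_fin.
Qed.

Lemma last_passage_height n : last_passage x n = (V n)%:E.
Proof.
apply/eqP; rewrite eq_le; apply/andP; split.
  apply: ge_ereal_sup => z [pi /= pi0n <-{z}].
  case: pi pi0n => // i s /and4P[_ /= s_path /eqP i0 /eqP <-].
  by have := path_weight_le s_path; rewrite {1}i0 add0e.
have [s [s_path s_last sV]] := path_weight_attained n.
apply: le_trans sV _; apply: ereal_sup_ubound.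
by exists (0%N :: s) => //=; rewrite /directed_path /= s_path s_last !eqxx.
Qed.
End LastPassageHeight.

(** * The Poisson equation *)

Section PoissonEquation.
Context {R : realFieldType} {S X : finType} (f : S -> X -> S).

Section Harmonic.
Variables (w : X -> R) (x0 : X) (L : nat).
Hypotheses (w_ge0 : forall x, 0 <= w x) (w_x0 : 0 < w x0).
Hypothesis sync : forall s s', iter L (f^~ x0) s = iter L (f^~ x0) s'.

(** Maximum principle: at a maximiser of [h] all changes are nonpositive, so [c <= 0]. If [c = 0],
    the letter [x0] leads from maximisers to maximisers, and after [L] steps the orbit reaches the
    synchronised state. *)
Lemma drift_max (h : S -> R) (c : R) (s0 : S) :
  (forall s, \sum_x w x * (h (f s x) - h s) = c) ->
  c <= 0 /\ (c = 0 -> forall s, h s <= h (iter L (f^~ x0) s0)).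
Proof.
move=> hc; have [t _ tmax] := @arg_maxP _ _ _ s0 xpredT h isT.
split=> [|c0 s].
  rewrite -(hc t); apply: sumr_le0 => x _.
  by rewrite mulr_ge0_le0// subr_le0; exact: tmax.
have step u : h u = h t -> h (f u x0) = h t.
  move=> ut; apply/eqP; rewrite -ut -subr_eq0.
  have /eqP := hc u; rewrite c0 -oppr_eq0 -sumrN.
  rewrite psumr_eq0 => [/allP/(_ x0 (mem_index_enum _))|x _].
    by rewrite /= oppr_eq0 mulf_eq0 gt_eqF.
  by rewrite oppr_ge0 mulr_ge0_le0 // subr_le0 ut; exact: tmax.
rewrite (sync s0 t); apply: le_trans (tmax s isT) _.
have -> // : h (iter L (f^~ x0) t) = h t.
by elim: L => // l ih; rewrite iterS step.
Qed.

(** Applied to [h] and [- h], the maximum principle puts both the maximum and the minimum of [h] at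
    the same synchronised state. *)
Lemma harmonic_const (h : S -> R) (c : R) (s0 : S) :
  (forall s, \sum_x w x * (h (f s x) - h s) = c) ->
  c = 0 /\ forall s, h s = h s0.
Proof.
move=> hc; have [c_le0 hmax] := drift_max s0 hc.
have hcN s : \sum_x w x * (- h (f s x) - - h s) = - c.
  by rewrite -(hc s) -sumrN; apply: eq_bigr => x _; ring.
have [Nc_le0 hmin] := drift_max s0 hcN.
have c0 : c = 0 by apply/eqP; rewrite eq_le c_le0 -oppr_le0 Nc_le0.
have hE s : h s = h (iter L (f^~ x0) s0).
  by apply/eqP; rewrite eq_le hmax//= -lerN2 hmin// c0 oppr0.
by split=> // s; rewrite (hE s) (hE s0).
Qed.

End Harmonic.

Variables (s0 : S) (g : S -> X -> R) (w : X -> {poly R}).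

(* The unknowns are h(t) for t != s0, with the normalisation h(s0) = 0, and the
   drift, stored at index s0. *)
Definition poisson_mx : 'M[{poly R}]_#|S| :=
  \matrix_(t, s) (if enum_val t == s0 then -1 else
    \sum_x w x *+ (f (enum_val s) x == enum_val t) -
    (enum_val s == enum_val t)%:R).

Definition poisson_rhs : 'rV[{poly R}]_#|S| :=
  \row_s (- \sum_x w x * (g (enum_val s) x)%:P).

Definition potential (v : 'rV[R]_#|S|) (t : S) : R :=
  if t == s0 then 0 else v 0 (enum_rank t).

Lemma mul_poisson_mx (p : R) (v : 'rV[R]_#|S|) (s : S) :
  \sum_x (w x).[p] = 1 ->
  (v *m map_mx (horner_eval p) poisson_mx) 0 (enum_rank s) =
  \sum_x (w x).[p] * (potential v (f s x) - potential v s) -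
  v 0 (enum_rank s0).
Proof.
move=> w1; rewrite mxE (reindex enum_rank) /=; last exact/onW_bij/enum_rank_bij.
under eq_bigr => t _ do rewrite !mxE !enum_rankK.
rewrite (bigD1 s0)//= eqxx horner_evalE hornerN hornerC mulrN1 addrC.
congr (_ - _); under [RHS]eq_bigr => x _ do rewrite mulrBr.
rewrite sumrB -mulr_suml w1 mul1r.
(* The sum over [t != s0] extends to all [t] because the potential vanishes at [s0]. *)
transitivity (\sum_t (\sum_x (w x).[p] *+ (f s x == t) * potential v t
                      - (s == t)%:R * potential v t)).
  rewrite [RHS](bigD1 s0)//= [X in _ = X + _](_ : _ = 0) ?add0r; last first.
    rewrite {2}/potential eqxx mulr0 subr0 big1// => x _.
    by rewrite /potential eqxx mulr0.
  apply: eq_bigr => t ts0; rewrite /potential (negbTE ts0).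
  rewrite -mulr_suml -mulrBl mulrC.
  congr (_ * _); rewrite horner_evalE hornerD hornerN horner_sum.
  congr (_ - _); last by rewrite -polyC_natr hornerC.
  by apply: eq_bigr => x _; rewrite hornerMn.
rewrite sumrB exchange_big/=; congr (_ - _).
  apply: eq_bigr => x _; rewrite (bigD1 (f s x))//= eqxx mulr1n.
  by rewrite big1 ?addr0// => t /negbTE; rewrite eq_sym => ->; rewrite mulr0n mul0r.
rewrite (bigD1 s)//= eqxx mul1r.
by rewrite big1 ?addr0// => t /negbTE; rewrite eq_sym => ->; rewrite mul0r.
Qed.

(** Cramer's rule: the drift is one coordinate of the adjugate solution divided by the determinant,
    both polynomials. A kernel vector at [p] would be a potential of constant drift, hence constant,
    hence zero by normalisation, so the determinant does not vanish. *)
Lemma poisson_rational : exists A B : {poly R}, forall p : R,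
  (forall x, 0 <= (w x).[p]) -> \sum_x (w x).[p] = 1 ->
  (exists x L, 0 < (w x).[p] /\
    forall s s', iter L (f^~ x) s = iter L (f^~ x) s') ->
  B.[p] != 0 /\ exists h : S -> R, forall s,
    \sum_x (w x).[p] * (g s x + h (f s x) - h s) = A.[p] / B.[p].
Proof.
exists ((poisson_rhs *m \adj poisson_mx) 0 (enum_rank s0)), (\det poisson_mx).
move=> p w_ge0 w1 [x0 [L [wx0 sync]]].
set Q := map_mx (horner_eval p) poisson_mx.
have detQ : (\det poisson_mx).[p] = \det Q by rewrite det_map_mx.
have Q0 : \det Q != 0.
  apply/det0P => -[v v0 vQ].
  have hc s : \sum_x (w x).[p] * (potential v (f s x) - potential v s) =
      v 0 (enum_rank s0).
    by apply/eqP; rewrite -subr_eq0 -mul_poisson_mx// vQ mxE.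
  have [vs0 vE] := harmonic_const w_ge0 wx0 sync s0 hc.
  case/eqP: v0; apply/rowP => i; rewrite mxE -(enum_valK i).
  have := vE (enum_val i); rewrite /potential eqxx.
  by case: eqP => [->|].
rewrite detQ; split=> //.
have Qu : Q \in unitmx by rewrite unitmxE unitfE.
set r := map_mx (horner_eval p) poisson_rhs.
pose v := r *m invmx Q.
exists (potential v) => s.
have := mul_poisson_mx v s w1; rewrite -/Q.
have -> : v 0 (enum_rank s0) =
    ((poisson_rhs *m \adj poisson_mx) 0 (enum_rank s0)).[p] / \det Q.
  rewrite /v /invmx Qu -scalemxAr mxE mulrC; congr (_ / _).
  by rewrite /r -map_mx_adj -map_mxM mxE.
have -> : v *m Q = r by rewrite mulmxKV.
rewrite !mxE enum_rankK horner_evalE hornerN horner_sum.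
under eq_bigr => x _ do rewrite hornerM hornerC.
move=> e; apply/eqP; rewrite -subr_eq0; apply/eqP.
under eq_bigr => x _ do rewrite -addrA mulrDr.
by rewrite big_split /= -addrA -e subrr.
Qed.
End PoissonEquation.

(** * Law of large numbers for additive functionals *)

Section AdditiveFunctional.
Context {R : realType} {S X : finType} (f : S -> X -> S).

Fixpoint cumulated (g : S -> X -> R) (s : S) (l : seq X) : R :=
  if l is x :: l' then g s x + cumulated g (f s x) l' else 0.

Fixpoint words (n : nat) : seq (seq X) :=
  if n is n'.+1 then [seq x :: l | x <- enum X, l <- words n'] else [:: [::]].

Lemma cumulated_rcons g s l x :
  cumulated g s (rcons l x) = cumulated g s l + g (foldl f s l) x.
Proof.
elim: l s => [|y l ih] s /=; first by rewrite addr0 add0r.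
by rewrite ih addrA.
Qed.

Lemma cumulatedN g s l :
  cumulated (fun s x => - g s x) s l = - cumulated g s l.
Proof. by elim: l s => [|y l ih] s /=; rewrite ?oppr0// ih opprD. Qed.

Lemma mem_words l : l \in words (size l).
Proof.
elim: l => [|x l ih] /=; first by rewrite inE.
by apply/allpairsP; exists (x, l); split=> //=; rewrite mem_enum.
Qed.

(** From [expR (- t) >= 1 - t] follows [expR t <= (1 - t)^-1], and the product of [1 - t] with the
    right-hand side is [1 + t ^+ 2 * (1 - 2 * t) >= 1]. *)
Lemma expR_le_quadratic (t : R) : `|t| <= 2^-1 -> expR t <= 1 + t + 2 * t ^+ 2.
Proof.
rewrite ler_norml => /andP[t1 t2].
have := expR_ge1Dx (- t); rewrite expRN => h.
have h1 : 0 < 1 - t by lra.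
have : expR t <= (1 - t)^-1.
  by rewrite -[expR t]invrK lef_pV2// ?posrE ?invr_gt0 ?expR_gt0.
move=> /le_trans; apply; rewrite -[leLHS]mul1r ler_pdivrMr//.
have : 0 <= t ^+ 2 * (1 - 2 * t) by rewrite mulr_ge0 ?sqr_ge0//; lra.
lra.
Qed.

Section Chernoff.
Variables (w : X -> R) (g : S -> X -> R) (B : R).
Hypotheses (w_ge0 : forall x, 0 <= w x) (w_sum1 : \sum_x w x = 1).
Hypotheses (g_mean0 : forall s, \sum_x w x * g s x = 0).
Hypotheses (B_gt0 : 0 < B) (g_bound : forall s x, `|g s x| <= B).

Definition word_weight (l : seq X) : R := \prod_(x <- l) w x.

Lemma word_weight_ge0 l : 0 <= word_weight l.
Proof. by apply: prodr_ge0 => x _. Qed.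

Lemma exp_moment_step (lam : R) s : 0 <= lam -> lam * B <= 2^-1 ->
  \sum_x w x * expR (lam * g s x) <= expR (2 * (lam * B) ^+ 2).
Proof.
move=> lam0 lamB; apply: le_trans (expR_ge1Dx _).
apply: le_trans (_ : \sum_x (w x + lam * (w x * g s x) +
    w x * (2 * (lam * B) ^+ 2)) <= _).
  apply: ler_sum => x _.
  rewrite (_ : _ + _ = w x * (1 + lam * g s x + 2 * (lam * B) ^+ 2)); last by ring.
  have lamg : `|lam * g s x| <= lam * B.
    by rewrite normrM ger0_norm// ler_wpM2l.
  apply: ler_wpM2l => //; apply: le_trans (expR_le_quadratic _) _.
    exact: le_trans lamg lamB.
  rewrite lerD2l ler_pM2l// -(real_normK (num_real (lam * g s x))).
  by rewrite lerXn2r// nnegrE// mulr_ge0// ltW.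
by rewrite 2!big_split /= -mulr_suml -mulr_sumr w_sum1 g_mean0 mulr0 addr0 mul1r.
Qed.

(** The one-step bound is uniform in the state, so conditioning on the first letter multiplies the
    bounds although the increments are dependent. *)
Lemma exp_moment (lam : R) n s : 0 <= lam -> lam * B <= 2^-1 ->
  \sum_(l <- words n) word_weight l * expR (lam * cumulated g s l) <=
  expR (2 * (lam * B) ^+ 2) ^+ n.
Proof.
move=> lam0 lamB; elim: n s => [|n ih] s /=.
  by rewrite big_seq1 /word_weight big_nil mulr0 expR0 mul1r.
rewrite big_allpairs_dep big_enum /=.
apply: le_trans (_ : \sum_x (w x * expR (lam * g s x)) *
    expR (2 * (lam * B) ^+ 2) ^+ n <= _); last first.
  rewrite -mulr_suml [_ ^+ n.+1]exprS ler_wpM2r ?exprn_ge0 ?expR_ge0//.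
  exact: exp_moment_step.
apply: ler_sum => x _.
apply: le_trans (ler_wpM2l _ (ih (f s x))); last first.
  by rewrite mulr_ge0 ?expR_ge0.
rewrite mulr_sumr le_eqVlt; apply/orP; left; apply/eqP; apply: eq_bigr => l _.
rewrite /word_weight big_cons /= mulrDr expRD; ring.
Qed.

Lemma chernoff (e : R) : 0 < e -> exists2 r : R, 0 < r < 1 &
  forall n s, \sum_(l <- words n | n%:R * e <= cumulated g s l) word_weight l
              <= r ^+ n.
Proof.
(* In the denominator, [2 * B * e] ensures [lam * B <= 2^-1], and [4 * B ^+ 2] makes the quadratic
   cost smaller than the gain [lam * e]. *)
move=> e0; pose lam := e / (4 * B ^+ 2 + 2 * B * e).
have den0 : 0 < 4 * B ^+ 2 + 2 * B * e.
  by rewrite addr_gt0 ?mulr_gt0 ?exprn_gt0.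
have lam0 : 0 < lam by rewrite divr_gt0.
have lamB : lam * B <= 2^-1.
  rewrite /lam mulrAC ler_pdivrMr//.
  have : 0 <= B ^+ 2 by rewrite exprn_ge0// ltW.
  lra.
have lamBe : 2 * (lam * B) ^+ 2 < lam * e.
  rewrite (_ : 2 * (lam * B) ^+ 2 = lam * (2 * lam * B ^+ 2)); last by ring.
  rewrite ltr_pM2l// /lam mulrA mulrAC ltr_pdivrMr//.
  have : 0 < B ^+ 2 * e by rewrite mulr_gt0 ?exprn_gt0.
  have : 0 < B * e * e by rewrite !mulr_gt0.
  lra.
exists (expR (2 * (lam * B) ^+ 2 - lam * e)).
  by rewrite expR_gt0 expR_lt1 subr_lt0.
move=> n s; apply: le_trans (_ : \sum_(l <- words n)
    word_weight l * expR (lam * cumulated g s l) * expR (- (lam * e)) ^+ n <= _).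
  rewrite big_mkcond; apply: ler_sum => l _; case: ifP => [h|_]; last first.
    by rewrite !mulr_ge0 ?exprn_ge0 ?expR_ge0 ?word_weight_ge0.
  rewrite -mulrA ler_peMr ?word_weight_ge0// -expRM_natl -expRD.
  rewrite -[leLHS]expR0 ler_expR.
  have : lam * (n%:R * e) <= lam * cumulated g s l by rewrite ler_pM2l.
  lra.
rewrite -mulr_suml expRD exprMn ler_wpM2r ?exprn_ge0 ?expR_ge0//.
by apply: exp_moment => //; exact: ltW.
Qed.

End Chernoff.

Section LawOfLargeNumbers.
Variables (w : X -> R) (B : R) (s0 : S).
Hypotheses (w_ge0 : forall x, 0 <= w x) (w_sum1 : \sum_x w x = 1).
Hypothesis B_gt0 : 0 < B.
Context d (T : measurableType d) (P : probability T R) (xi : nat -> T -> X).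
Local Notation word n t := (mkseq (xi^~ t) n).

Definition cylinder (l : seq X) : set T := [set t | word (size l) t = l].

Hypothesis cylinder_measurable : forall l, measurable (cylinder l).
Hypothesis cylinder_prob : forall l, P (cylinder l) = (word_weight w l)%:E.

Lemma measure_bigcup_cylinder_le (r : seq (seq X)) (C : pred (seq X)) :
  (P (\big[setU/set0]_(l <- r | C l) cylinder l) <=
   (\sum_(l <- r | C l) word_weight w l)%:E)%E.
Proof.
elim: r => [|l r ih]; first by rewrite !big_nil measure0.
rewrite !big_cons; case: ifP => // _.
apply: le_trans (measureU2 _ _ _) _ => //.
  exact: bigsetU_measurable.
by rewrite EFinD -cylinder_prob leeD2l.
Qed.

(** Borel-Cantelli: the bad event at time [n] is a finite union of cylinders, and the exponential
    Markov inequality bounds its probability by a summable geometric term. *)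
Lemma ae_cumulated_lt (g : S -> X -> R) (e : R) :
  (forall s, \sum_x w x * g s x = 0) -> (forall s x, `|g s x| <= B) ->
  0 < e ->
  {ae P, forall t, \forall n \near \oo, cumulated g s0 (word n t) < n%:R * e}.
Proof.
move=> g_mean0 g_bound e0.
have [r /andP[r0 r1] rP] := chernoff w_ge0 w_sum1 g_mean0 B_gt0 g_bound e0.
pose bad n := \big[setU/set0]_(l <- words n | n%:R * e <= cumulated g s0 l)
  cylinder l.
have bad_measurable n : measurable (bad n) by exact: bigsetU_measurable.
have : P (lim_sup_set bad) = 0%E.
  apply: lim_sup_set_cvg0 => //.
  apply: (@le_lt_trans _ _ (\sum_(n <oo) (geometric 1 r n)%:E)%E).
    apply: lee_nneseries => // n _.
    apply: le_trans (measure_bigcup_cylinder_le _ _) _.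
    by rewrite lee_fin /geometric /= mul1r; exact: rP.
  have term_ge0 n : (0 <= (geometric 1 r n)%:E)%E.
    by rewrite lee_fin geometric_ge0 ?ler01 ?(ltW r0).
  apply: (@le_lt_trans _ _ ((1 * (1 - r)^-1)%:E)); last exact: ltry.
  apply: lime_le; first exact: is_cvg_nneseries.
  apply: nearW => n; rewrite sumEFin lee_fin.
  by apply: geometric_le_lim => //; rewrite ger0_norm ?ltW.
move=> bad0; exists (lim_sup_set bad); split=> //.
  by apply: bigcap_measurable => // k _; apply: bigcup_measurable.
move=> t /= tbad n _; apply: contrapT => tn; apply: tbad.
exists n => // k /= nk; rewrite ltNge; apply/negP => kbad.
apply: tn; exists k => //.
rewrite /bad -bigcup_seq_cond; exists (word k t); rewrite /cylinder /= ?size_mkseq//.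
by rewrite kbad andbT -{2}(size_mkseq (xi^~ t) k) mem_words.
Qed.

(** The one-sided bound is used for [g] and for [- g], with the thresholds [1 / k.+1%:R] only, so
    that countably many almost sure events are intersected. *)
Lemma cumulated_lln (g : S -> X -> R) :
  (forall s, \sum_x w x * g s x = 0) -> (forall s x, `|g s x| <= B) ->
  {ae P, forall t, cumulated g s0 (word n t) / n%:R @[n --> \oo] --> (0 : R)}.
Proof.
move=> g_mean0 g_bound.
have up k := ae_cumulated_lt g_mean0 g_bound (divr_gt0 ltr01 (ltr0Sn R k)).
have gN_mean0 s : \sum_x w x * - g s x = 0.
  by under eq_bigr do rewrite mulrN; rewrite sumrN g_mean0 oppr0.
have gN_bound s x : `|- g s x| <= B by rewrite normrN.
have dn k := ae_cumulated_lt gN_mean0 gN_bound (divr_gt0 ltr01 (ltr0Sn R k)).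
have {}up := ae_foralln up.
have {}dn := ae_foralln dn.
apply: filterS2 up dn => t up dn.
apply/cvgrPdist_lt => e e0.
have [k _ ke] := near_infty_natSinv_lt (PosNum e0).
have {}ke := ke k (leqnn k).
near=> n.
have n_gt0 : 0 < n%:R :> R by rewrite ltr0n; near: n; exact: nbhs_infty_gt.
have upn : cumulated g s0 (word n t) < n%:R * (1 / k.+1%:R) by near: n; exact: up.
have dnn : - cumulated g s0 (word n t) < n%:R * (1 / k.+1%:R).
  by rewrite -cumulatedN; near: n; exact: dn.
rewrite sub0r normrN normrM normfV (ger0_norm (ler0n _ _)) ltr_pdivrMr//.
apply: lt_trans (_ : n%:R * (1 / k.+1%:R) < _); last first.
  by rewrite mulrC ltr_pM2r// div1r.
by rewrite ltr_norml ltrNl dnn.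
Unshelve. all: by end_near. Qed.
End LawOfLargeNumbers.
End AdditiveFunctional.

(** * Independent columns of edges *)

Section Columns.
Context {R : realType} (K : nat).

(* For k > n the edge (n - k, n + 1) does not exist; it is replaced by an edge
   of length > K, so that columns at all times are i.i.d. *)
Definition edge (n k : nat) : nat * nat :=
  if (k <= n)%N then ((n - k)%N, n.+1) else (n, (n + K.+1 + k)%N).

(** The length tells the two kinds of edge apart: [k + 1 <= K] for a genuine one, [K + 1 + k] for a
    substitute. Hence distinct pairs give distinct edges, as independence of the columns
    requires. *)
Definition edge_inv (e : nat * nat) : nat * nat :=
  if (e.2 - e.1 <= K)%N then (e.2.-1, (e.2 - e.1).-1)
  else (e.1, (e.2 - e.1 - K.+1)%N).

Lemma edgeK n k : (k < K)%N -> edge_inv (edge n k) = (n, k).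
Proof.
move=> kK; rewrite /edge /edge_inv; case: (leqP k n) => kn /=; case: ifP => h;
  congr pair; lia.
Qed.

Lemma edge_lt n k : ((edge n k).1 < (edge n k).2)%N.
Proof. by rewrite /edge; case: ifP => kn /=; lia. Qed.

Definition column_poly (a : {ffun 'I_K -> bool}) : {poly R} :=
  \prod_k (if a k then 'X else 1 - 'X).

Definition column_weight (q : R) (a : {ffun 'I_K -> bool}) : R :=
  \prod_k (if a k then q else 1 - q).

Lemma horner_column_poly q a : (column_poly a).[q] = column_weight q a.
Proof.
rewrite horner_prod; apply: eq_bigr => k _.
by case: ifP; rewrite !hornerE.
Qed.

Lemma column_weight_ge0 q a : 0 <= q <= 1 -> 0 <= column_weight q a.
Proof.
by move=> q01; apply: prodr_ge0 => k _; case: ifP => _; lra.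
Qed.

Lemma sum_column_weight q : \sum_a column_weight q a = 1.
Proof.
rewrite -(bigA_distr_bigA (fun=> fun b : bool => if b then q else 1 - q)).
by rewrite big1// => k _; rewrite big_bool /= addrC subrK.
Qed.

Context d (T : measurableType d) (P : probability T R).
Variables (nu : probability (\bar R) R) (X : nat * nat -> {RV P >-> \bar R}).
Variables (M q : R).
Hypothesis X_iid : iid nu [set e | (e.1 < e.2)%N] X.
Hypothesis nuM : nu [set M%:E] = q%:E.

Definition column (n : nat) (t : T) : {ffun 'I_K -> bool} :=
  [ffun k : 'I_K => X (edge n k) t == M%:E].

Let test (b : bool) : set (\bar R) := if b then [set M%:E] else ~` [set M%:E].

Let test_measurable b : measurable (test b).
Proof. by case: b => //=; apply: measurableC. Qed.

(** Independence is stated for events indexed by edges, so the entries of a word of columns are read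
    back from the edge. *)
Let letter (l : seq {ffun 'I_K -> bool}) (e : nat * nat) : bool :=
  if insub (edge_inv e).2 is Some k then nth [ffun=> false] l (edge_inv e).1 k
  else false.

Let letter_edge l n (k : 'I_K) : letter l (edge n k) = nth [ffun=> false] l n k.
Proof. by rewrite /letter edgeK//= valK. Qed.

Let edges N := [seq edge n (val k) | n <- iota 0 N, k <- enum 'I_K].

Lemma cylinder_column l : cylinder column l =
  \big[setI/setT]_(e <- edges (size l)) (X e @^-1` test (letter l e)).
Proof.
rewrite -bigcap_seq; apply/seteqP; split=> t.
  move=> /= tl e /= /allpairsP[[n k] /= [n_lt _ ->]].
  rewrite letter_edge; move: n_lt; rewrite mem_iota add0n => /= n_lt.
  rewrite -[in nth _ _ _]tl nth_mkseq// ffunE /test.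
  by case: eqP.
move=> tl; apply: (@eq_from_nth _ [ffun=> false]); rewrite size_mkseq// => n n_lt.
rewrite nth_mkseq//; apply/ffunP => k; rewrite ffunE.
have := tl (edge n k); rewrite /= letter_edge /test => /(_ _).
have ein : edge n k \in edges (size l).
  by apply/allpairsP; exists (n, k); rewrite /= mem_iota mem_enum add0n.
move=> /(_ ein); case: ifP => _ /=; first by move=> ->; rewrite eqxx.
by move=> /eqP /negbTE.
Qed.

Lemma cylinder_column_measurable l : measurable (cylinder column l).
Proof.
rewrite cylinder_column; apply: bigsetI_measurable => e _.
by rewrite -[X in measurable X]setTI; apply: measurable_funPT.
Qed.

Lemma cylinder_column_prob l :
  P (cylinder column l) = (word_weight (column_weight q) l)%:E.
Proof.
have [X_indep X_law] := X_iid.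
rewrite cylinder_column X_indep//; last first.
- move=> e /allpairsP[[n k] [_ _ ->]] /=; exact: edge_lt.
- rewrite /edges allpairs_uniq ?iota_uniq ?enum_uniq//.
  move=> [n k] [n' k'] _ _ /= /(congr1 edge_inv).
  by rewrite !edgeK// => -[-> /val_inj ->].
rewrite big_allpairs_dep /word_weight.
transitivity (\prod_(n <- iota 0 (size l))
    (column_weight q (nth [ffun=> false] l n))%:E)%E.
  rewrite big_seq [RHS]big_seq; apply: eq_bigr => n _.
  rewrite big_enum /= /column_weight.
  have -> : forall F : 'I_K -> R, (\prod_k F k)%:E = (\prod_k (F k)%:E)%E.
    by move=> F; elim/big_rec2: _ => // k _ y _ <-; rewrite EFinM.
  apply: eq_bigr => k _; rewrite letter_edge.
  rewrite -[LHS]/(distribution P (X (edge n k)) _) X_law//; last exact: edge_lt.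
  case: ifP => _ /=; rewrite ?nuM//.
  by rewrite probability_setC// nuM.
rewrite [in RHS](big_nth [ffun=> false]) /index_iota subn0.
by elim/big_rec2: _ => // n x y _ ->; rewrite EFinM.
Qed.

End Columns.

(** * The time constant of a two-valued law *)

Lemma cumulated_coboundary (R : realType) (S X : finType) (f : S -> X -> S)
    (g : S -> X -> R) (h : S -> R) (c : R) (s : S) (l : seq X) :
  cumulated f (fun s x => g s x + h (f s x) - h s - c) s l =
  cumulated f g s l + h (foldl f s l) - h s - (size l)%:R * c.
Proof.
elim: l s => [|x l ih] s /=; first by rewrite add0r subrr mul0r subrr.
by rewrite ih -natr1; ring.
Qed.

Lemma cvg_bounded_divn (R : realType) (u : nat -> R) (b : R) :
  (forall n, `|u n| <= b) -> u n / n%:R @[n --> \oo] --> (0 : R).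
Proof.
move=> ub; apply/cvgrPdist_lt => e e0; near=> n.
have nb : b / e < n%:R by near: n; exact: nbhs_infty_gtr.
have n_gt0 : 0 < n%:R :> R by rewrite ltr0n; near: n; exact: nbhs_infty_gt.
rewrite sub0r normrN normrM normfV (ger0_norm (ler0n _ _)) ltr_pdivrMr//.
by apply: le_lt_trans (ub n) _; rewrite mulrC -ltr_pdivrMr.
Unshelve. all: by end_near. Qed.

Section MarkovChain.
Context {R : realType} (m M : R) (K : nat).
Hypotheses (m_gt0 : 0 < m) (le_mM : m <= M) (K_large : M - m <= K%:R * m).

Definition state_increment (s : state m M K) (a : {ffun 'I_K -> bool}) : R :=
  increment m M (decode s) a.

Lemma height_cumulated (a : nat -> {ffun 'I_K -> bool}) n :
  height m M (fun n => a n) n =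
  cumulated (@advance _ m M K) state_increment (encode m M K (gap0 m M)) (mkseq a n).
Proof.
elim: n => [//|n ih]; rewrite mkseqS cumulated_rcons -ih /=; congr (_ + _).
apply: increment_ext => k; exact/esym/decode_foldl.
Qed.

(** For [q = 0] the all-[m] column has weight 1; otherwise the all-[M] column has positive weight
    and synchronises in one step. *)
Lemma advance_sync (q : R) : (0 < K)%N -> 0 <= q <= 1 ->
  exists (a : {ffun 'I_K -> bool}) L, 0 < column_weight q a /\
    forall s s' : state m M K,
      iter L ((@advance _ m M K)^~ a) s = iter L ((@advance _ m M K)^~ a) s'.
Proof.
move=> K_gt0 /andP[q0 q1]; have [->|q_neq0] := eqVneq q 0.
  exists [ffun=> false], K.+1; split; last exact: iter_advance_zeros_eq.
  by apply: prodr_gt0 => k _; rewrite ffunE subr0.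
exists [ffun=> true], 1%N; split; last by move=> s s'; exact: advance_ones.
by apply: prodr_gt0 => k _; rewrite ffunE lt0r q_neq0.
Qed.

End MarkovChain.

(** The law is described by its support and its mass [q] at [M], so that the degenerate case [m = M]
    is covered with [q = 1]. *)
Lemma is_time_constant_two_valued (R : realType) (m M : R) :
  0 < m -> m <= M ->
  exists A B : {poly R}, forall q : R, 0 <= q <= 1 ->
    B.[q] != 0 /\
    forall nu : probability (\bar R) R,
      nu [set M%:E] = q%:E -> nu [set m%:E; M%:E] = 1%E ->
      is_time_constant nu (A.[q] / B.[q])%:E.
Proof.
(* The Archimedean bound makes [K%:R * m] exceed [M - m]; the successor makes [K] positive, as
   [advance_sync] demands. *)
move=> m_gt0 le_mM; pose K := (Num.bound ((M - m) / m)).+1.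
have K_large : M - m <= K%:R * m.
  rewrite -ler_pdivrMr// ltW//; apply: lt_trans (archi_boundP _) _.
    by rewrite divr_ge0 ?subr_ge0// ltW.
  by rewrite ltr_nat.
pose s0 := encode m M K (gap0 m M).
have [A [B AB]] := poisson_rational (@advance _ m M K) s0
  (@state_increment _ m M K) (@column_poly R K).
exists A, B => q q01.
have [||| Bq [h hE]] := AB q.
- by move=> a; rewrite horner_column_poly column_weight_ge0.
- by under eq_bigr do rewrite horner_column_poly; exact: sum_column_weight.
- have [a [L [a0 sync]]] := advance_sync m_gt0 le_mM K_large (ltn0Sn _) q01.
  by exists a, L; rewrite horner_column_poly.
split=> // nu nuM nu1 d T P X X_iid.
set c := A.[q] / B.[q] in hE *.
(* The Poisson equation gives this corrected increment mean zero in every state: these are the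
   martingale differences. *)
pose G (s : state m M K) a :=
  state_increment s a + h (advance s a) - h s - c.
have G_mean0 s : \sum_a column_weight q a * G s a = 0.
  under eq_bigr => a _ do rewrite mulrBr.
  rewrite sumrB -mulr_suml sum_column_weight mul1r; apply/eqP.
  rewrite subr_eq0 -(hE s).
  by under [eqbRHS]eq_bigr do rewrite horner_column_poly.
(* The summand 1 keeps the bound positive even if [G] vanishes identically. *)
pose bound := \sum_s \sum_a `|G s a| + 1.
have G_bound s a : `|G s a| <= bound.
  rewrite /bound (bigD1 s)//= (bigD1 a)//= -!addrA lerDl.
  rewrite !addr_ge0// sumr_ge0// => ? _.
  by rewrite sumr_ge0.
have bound_gt0 : 0 < bound.
  by rewrite ltr_wpDl// sumr_ge0// => s _; rewrite sumr_ge0.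
have lln := cumulated_lln (@advance _ m M K) s0
  (fun a => column_weight_ge0 a q01)
  (sum_column_weight K q) bound_gt0 (cylinder_column_measurable (K := K) X M)
  (cylinder_column_prob (K := K) X_iid nuM) G_mean0 G_bound.
have values : {ae P, forall t, forall i j, (i < j)%N ->
    X (i, j) t = m%:E \/ X (i, j) t = M%:E}.
  apply: ae_foralln => i; apply: ae_foralln => j.
  have [ij|ji] := ltnP i j; last exact: aeW.
  have vm : measurable [set m%:E; M%:E : \bar R] by exact: measurableU.
  exists (X (i, j) @^-1` ~` [set m%:E; M%:E]); split.
  - rewrite -[X in measurable X]setTI.
    by apply: measurable_funPT => //; exact: measurableC.
  - rewrite -[LHS]/(distribution P (X (i, j)) _).
    rewrite (proj2 X_iid) ?probability_setC//; last exact: measurableC.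
    by rewrite nu1 subee.
  - by move=> t /= + tv; apply => _; case: tv; [left|right].
apply: filterS2 lln values => t lln values.
pose y i j := if X (i, j) t == M%:E then M else m.
have W n : last_passage (fun i j => X (i, j) t) n =
    (cumulated (@advance _ m M K) (@state_increment _ m M K) s0
      (mkseq (fun n => column K X M n t) n))%:E.
  rewrite -height_cumulated//.
  apply: (last_passage_height m_gt0 le_mM K_large (y := y)).
  - by move=> i j _; rewrite /y; case: ifP; [right|left].
  - move=> n' k kn; rewrite ffunE /edge kn /y; case: eqP => [|XM].
      by rewrite eqxx.
    (* If [m = M], the value [m] of [y] would also pass for [M]; but then the almost sure values
       force the weight to be [M]. *)
    apply/esym/eqP => mM; apply: XM.
    have lt : (n' - k < n'.+1)%N by rewrite ltnS leq_subr.
    by have [|//] := values _ _ lt; rewrite mM.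
  - move=> i j ij; rewrite /y; case: eqP => [//|XM].
    by have [|] := values i j ij.
apply: cvg_EFin; first by apply: nearW => n; rewrite W.
set V := cumulated _ _ _ in W.
rewrite [X in X @ _](_ : _ = fun n =>
  V (mkseq (fun n => column K X M n t) n) / n%:R); last first.
  by apply/funext => n /=; rewrite W.
pose s n := foldl (@advance _ m M K) s0 (mkseq (fun n => column K X M n t) n).
have hs : (h (s n) - h s0) / n%:R @[n --> \oo] --> (0 : R).
  apply: (@cvg_bounded_divn _ _ (\sum_s `|h s - h s0|)) => n.
  by rewrite (bigD1 (s n))//= lerDl sumr_ge0.
(* By telescoping, the mean height is the martingale average plus [c], minus a bounded boundary term
   divided by [n]. *)
have lim : cumulated (@advance _ m M K) G s0
    (mkseq (fun n => column K X M n t) n) / n%:R + c - (h (s n) - h s0) / n%:R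
    @[n --> \oo] --> 0 + c - 0.
  by apply: cvgB => //; apply: cvgD => //; exact: cvg_cst.
rewrite add0r subr0 in lim; apply: cvg_trans lim; apply: near_eq_cvg; near=> n.
(* At [n = 0] every quotient is 0 while [c] remains, so the identity is only claimed eventually. *)
have n_neq0 : n%:R != 0 :> R.
  by rewrite pnatr_eq0 -lt0n; near: n; exact: nbhs_infty_gt.
rewrite /= /G cumulated_coboundary size_mkseq -/V -/(s n).
by field.
Unshelve. all: by end_near. Qed.

(** * An i.i.d. family on the unit interval *)

Lemma rescale_unit (R : realFieldType) (b r x : R) : 0 < r ->
  (0 <= (x - b) / r < 1) = (b <= x < b + r).
Proof.
move=> r0; rewrite ltr_pdivrMr// ler_pdivlMr// mul0r mul1r subr_ge0.
by rewrite ltrBlDl.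
Qed.

Section UnitInterval.
Context {R : realType}.
Local Notation mu := (@lebesgue_measure R).
Local Notation rescale b r :=
  (fun x : measurableTypeR R => (x - b) / r : measurableTypeR R).

Lemma measurable_rescale (b r : R) : measurable_fun setT (rescale b r).
Proof.
apply: measurable_funM; last exact: measurable_cst.
by apply: measurable_funB; [exact: measurable_id|exact: measurable_cst].
Qed.

(** The pushforward under the rescaling, multiplied by [r^-1], gives half-open intervals their
    length, so it is Lebesgue measure by uniqueness. *)
Lemma lebesgue_measure_rescale (b r : R) (A : set (measurableTypeR R)) :
  0 < r -> measurable A -> mu (rescale b r @^-1` A) = (r%:E * mu A)%E.
Proof.
move=> r0 mA.
have ri0 : 0 <= r^-1 by rewrite invr_ge0 ltW.
suff -> : mu A = (r^-1%:E * mu (rescale b r @^-1` A))%E.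
  by rewrite muleA -EFinM divff ?gt_eqF// mul1e.
have mf := measurable_rescale b r.
pose nu : {measure set (measurableTypeR R) -> \bar R} :=
  mscale (NngNum ri0) (pushforward mu (rescale b r)).
rewrite (@lebesgue_measure_unique R (nu mf))// => _ [[x y] _ <-].
rewrite /nu /= /mscale /= /pushforward /=.
have -> : rescale b r @^-1` `]x, y] = `]b + r * x, b + r * y]%classic.
  apply/seteqP; split => z /=; rewrite !in_itv/=.
    by rewrite ltr_pdivlMr// ler_pdivrMr// => /andP[? ?]; apply/andP; split; lra.
  by rewrite ltr_pdivlMr// ler_pdivrMr// => /andP[? ?]; apply/andP; split; lra.
rewrite !lebesgue_measure_itv /= !lte_fin ltrD2l ltr_pM2l//.
case: ifP => _; last by rewrite mule0.
by rewrite -EFinM -!EFinB; congr EFin; field; rewrite gt_eqF.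
Qed.

Definition unit_interval : set (measurableTypeR R) := `[0, 1[%classic.

Lemma measurable_unit_interval : measurable unit_interval.
Proof. exact: measurable_itv. Qed.

Definition uniform : set (measurableTypeR R) -> \bar R :=
  mrestr mu measurable_unit_interval.

HB.instance Definition _ := Measure.on uniform.

Lemma uniform_setT : uniform setT = 1%E.
Proof.
rewrite /uniform /mrestr setTI lebesgue_measure_itv /= lte_fin ltr01.
by rewrite -EFinB subr0.
Qed.

HB.instance Definition _ :=
  Measure_isProbability.Build _ _ R uniform uniform_setT.

(** The case [r = 0], where the interval is empty, serves the parameters [q = 0] and [q = 1]. *)
Lemma uniform_rescale (b r : R) (A : set (measurableTypeR R)) :
  0 <= r -> measurable A ->
  mu (`[b, b + r[%classic `&` rescale b r @^-1` A) = (r%:E * uniform A)%E.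
Proof.
rewrite le_eqVlt => /orP[/eqP <-|r0] mA.
  by rewrite addr0 set_itvco0 set0I measure0 mul0e.
rewrite /uniform /mrestr -(lebesgue_measure_rescale b r0); last first.
  by apply: measurableI => //; exact: measurable_unit_interval.
rewrite /unit_interval; congr (mu _).
apply/seteqP; split => x /=; rewrite !in_itv/=.
  by rewrite rescale_unit // => -[].
by rewrite rescale_unit // => -[].
Qed.

Section Digits.
Variable q : R.
Hypothesis q01 : 0 <= q <= 1.

Definition digit (x : measurableTypeR R) : bool := 1 - q <= x.

(** Each of the intervals [[0, 1 - q[] and [[1 - q, 1[], when nonempty, is stretched onto [[0, 1[].
    Iterating this map yields the successive digits of the expansion. *)
Definition digit_tail (x : measurableTypeR R) : measurableTypeR R :=
  if digit x then (x - (1 - q)) / q else (x - 0) / (1 - q).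

Lemma measurable_digit : measurable_fun setT digit.
Proof. exact: measurable_fun_ler. Qed.

Lemma measurable_digit_tail : measurable_fun setT digit_tail.
Proof.
apply: measurable_fun_ifT; first exact: measurable_digit.
  exact: measurable_rescale.
exact: measurable_rescale.
Qed.

(** The first digit is independent of the tail, and the tail is again uniform; this single step,
    iterated, makes the digits i.i.d. *)
Lemma uniform_digit_tail (c : bool) (A : set (measurableTypeR R)) :
  measurable A ->
  uniform ([set x | digit x = c] `&` digit_tail @^-1` A) =
  ((if c then q else 1 - q)%:E * uniform A)%E.
Proof.
move=> mA; case/andP: q01 => q0 q1.
have q1_ge0 : 0 <= 1 - q by rewrite subr_ge0.
case: c.
  rewrite -(@uniform_rescale (1 - q))// subrK /uniform /mrestr; congr (mu _).
  apply/seteqP; split => x; rewrite /= /digit_tail /digit /= !in_itv/=.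
    by move=> [[-> ?] /andP[? ?]].
  move=> [/andP[h ?] ?]; rewrite h; split=> //; apply/andP; split=> //.
  exact: le_trans h.
rewrite -(@uniform_rescale 0)// add0r /uniform /mrestr; congr (mu _).
apply/seteqP; split => x; rewrite /= /digit_tail /digit /= !in_itv/=.
  move=> [[h]]; rewrite h => ? /andP[? ?]; split=> //.
  by apply/andP; split=> //; rewrite ltNge h.
move=> [/andP[? h] ?]; rewrite leNgt h; split=> //.
by apply/andP; split=> //; apply: lt_le_trans h _; rewrite gerBl.
Qed.

End Digits.
End UnitInterval.

Section IidFamily.
Context {R : realType} (p : {i01 R}) (m M : R).
Local Notation q := (p%:num).
Local Notation nu := (two_point p m M).
Local Notation P := (@uniform R).

Let q01 : 0 <= q <= 1.
Proof. by apply/andP; split. Qed.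

Definition letter_value (c : bool) : \bar R := if c then M%:E else m%:E.

Definition digit_value (n : nat) (x : measurableTypeR R) : \bar R :=
  letter_value (digit q (iter n (digit_tail q) x)).

Lemma measurable_letter_digit :
  measurable_fun setT (letter_value \o digit (q : R)).
Proof.
by apply: measurable_fun_ifT; first exact: measurable_digit.
Qed.

Lemma measurable_digit_value n : measurable_fun setT (digit_value n).
Proof.
apply: (measurableT_comp measurable_letter_digit).
elim: n => [|n ih] /=; first exact: measurable_id.
exact: (measurableT_comp (measurable_digit_tail _)).
Qed.

Lemma two_point_split (B : set (\bar R)) :
  nu B = ((if m%:E \in B then 1 - q else 0) + (if M%:E \in B then q else 0))%:E.
Proof.
rewrite two_pointE !diracE EFinD.
by do 2![case: ifP => _]; rewrite ?mule1 ?mule0.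
Qed.

Lemma uniform_digit_value (B : set (\bar R)) (A : set (measurableTypeR R)) :
  measurable A ->
  P ((letter_value \o digit q) @^-1` B `&` digit_tail q @^-1` A) =
  (nu B * P A)%E.
Proof.
move=> mA.
have mc c : measurable ([set x | digit q x = c] `&` digit_tail q @^-1` A).
  apply: measurableI; rewrite -[X in measurable X]setTI.
    exact: (measurable_digit (q : R) measurableT (Y := [set c])).
  exact: measurable_digit_tail.
have -> : (letter_value \o digit q) @^-1` B `&` digit_tail q @^-1` A =
  (if m%:E \in B then [set x | digit q x = false] `&` digit_tail q @^-1` A
   else set0) `|`
  (if M%:E \in B then [set x | digit q x = true] `&` digit_tail q @^-1` A
   else set0).
  apply/seteqP; split => x /=.
    case=> + Ax; rewrite /letter_value.
    by case dx : (digit q x) => Bx; [right|left]; rewrite mem_set.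
  by case; case: ifP => // /set_mem Bx [dx Ax]; rewrite /letter_value dx.
rewrite measureU//=.
- rewrite two_point_split EFinD ge0_muleDl; last 2 first.
  + by case: ifP.
  + by case: ifP.
  by congr (_ + _)%E; case: ifP => _; rewrite ?measure0 ?mul0e// uniform_digit_tail.
- by case: ifP.
- by case: ifP.
- rewrite -subset0 => x [].
  by do 2![case: ifP => _ //] => -[/= -> _] [].
Qed.

Definition digit_event (N : nat) (B : nat -> set (\bar R)) :
    set (measurableTypeR R) :=
  [set x | forall n, (n < N)%N -> B n (digit_value n x)].

Lemma digit_eventS N B : digit_event N.+1 B =
  (letter_value \o digit q) @^-1` (B 0%N) `&`
  digit_tail q @^-1` (digit_event N (B \o succn)).
Proof.
apply/seteqP; split => x /=.
  move=> xB; split; first exact: (xB 0%N).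
  by move=> n nN /=; have := xB n.+1 nN; rewrite /digit_value iterSr.
move=> [xB0 xB] [//|n] nN; have := xB n nN.
by rewrite /digit_value iterSr.
Qed.

Lemma digit_event_prob N B : (forall n, measurable (B n)) ->
  measurable (digit_event N B) /\
  P (digit_event N B) = (\prod_(0 <= n < N) nu (B n))%E.
Proof.
elim: N B => [|N ih] B mB.
  have -> : digit_event 0 B = setT by apply/seteqP; split.
  by rewrite big_geq// probability_setT.
have [mE PE] := ih (B \o succn) (fun n => mB n.+1).
rewrite digit_eventS uniform_digit_value//; split.
  apply: measurableI; rewrite -[X in measurable X]setTI.
    exact: measurable_letter_digit.
  exact: measurable_digit_tail.
by rewrite big_nat_recl//= PE.
Qed.

Lemma digit_value_indep (s : seq nat) (B : nat -> set (\bar R)) :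
  uniq s -> (forall n, measurable (B n)) ->
  P (\big[setI/setT]_(n <- s) (digit_value n @^-1` B n)) =
  (\prod_(n <- s) nu (B n))%E.
Proof.
move=> s_uniq mB; pose N := (\max_(n <- s) n).+1.
have sN n : n \in s -> (n < N)%N.
  by move=> ns; rewrite ltnS; exact: leq_bigmax_seq.
(* Indices outside [s] receive the whole space, which turns the event into one about an initial
   segment of digits. *)
pose B' n := if n \in s then B n else setT.
have mB' n : measurable (B' n) by rewrite /B'; case: ifP.
have -> : \big[setI/setT]_(n <- s) (digit_value n @^-1` B n) = digit_event N B'.
  rewrite -bigcap_seq; apply/seteqP; split => x /= xB n.
    by move=> nN; rewrite /B'; case: ifP => // ns; exact: xB.
  by move=> ns; have := xB n (sN n ns); rewrite /B' ns.
rewrite (digit_event_prob N mB').2.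
transitivity (\prod_(0 <= n < N | n \in s) nu (B n))%E.
  rewrite [RHS]big_mkcond; apply: eq_bigr => n _; rewrite /B'.
  by case: ifP => // _; exact: probability_setT.
rewrite -big_filter; apply: perm_big; apply: uniq_perm => //.
  by rewrite filter_uniq// iota_uniq.
move=> n; rewrite mem_filter mem_index_iota /=.
by case: (boolP (n \in s)) => // /sN ->.
Qed.

(** [pickle] numbers the edges injectively, so distinct edges read distinct digits. *)
Definition digit_rv (e : nat * nat) : measurableTypeR R -> \bar R :=
  digit_value (pickle e).

HB.instance Definition _ (e : nat * nat) :=
  isMeasurableFun.Build _ _ _ _ (digit_rv e) (measurable_digit_value (pickle e)).

Lemma digit_rv_iid : iid (P := P) nu [set e : nat * nat | (e.1 < e.2)%N]
  (fun e => digit_rv e : {RV P >-> \bar R}).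
Proof.
have law e B : measurable B -> P (digit_rv e @^-1` B) = nu B.
  move=> mB; have := @digit_value_indep [:: pickle e] (fun=> B) isT (fun=> mB).
  by rewrite !big_seq1.
split=> [s B s_uniq _ mB|e B _ mB]; last exact: law.
pose B' n := if unpickle n is Some e then B e else setT.
have B'E e : B' (pickle e) = B e by rewrite /B' pickleK.
have mB' n : measurable (B' n) by rewrite /B'; case: unpickle.
have := @digit_value_indep [seq pickle e | e <- s] B' _ mB'.
rewrite !big_map map_inj_uniq; last exact: (pcan_inj pickleK).
move=> /(_ s_uniq) indep.
transitivity (\prod_(e <- s) nu (B' (pickle e)))%E; last first.
  by apply: eq_bigr => e _; rewrite B'E; exact/esym/law.
by rewrite -indep; congr (P _); apply: eq_bigr => e _; rewrite B'E.
Qed.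

End IidFamily.

(** * Uniqueness of the time constant and conclusion *)

Lemma is_time_constant_unique (R : realType) (p : {i01 R}) (m M : R)
    (c c' : \bar R) :
  is_time_constant (two_point p m M) c ->
  is_time_constant (two_point p m M) c' -> c = c'.
Proof.
(* Both constants are tested on the digit family. Two almost sure events meet because the total mass
   is positive, and at a common point the limits agree. *)
move=> /(_ _ _ _ _ (digit_rv_iid p m M)) hc /(_ _ _ _ _ (digit_rv_iid p m M)) hc'.
have uniform_gt0 : (0 < @uniform R setT)%E by rewrite uniform_setT lte01.
have ae_proper := ae_properfilter_algebraOfSetsType uniform_gt0.
have [t [h h']] := filter_ex (@filterI _ _ ae_proper _ _ hc hc').
exact: cvg_unique h h'.
Qed.

Lemma time_constantE (R : realType) (p : {i01 R}) (m M : R) (c : \bar R) :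
  is_time_constant (two_point p m M) c -> time_constant (two_point p m M) = c.
Proof.
move=> hc; apply: xget_unique => // c' hc'.
exact: is_time_constant_unique hc' hc.
Qed.

Theorem theorem1p9 (R : realType) (m M : R) (hm : 0 < m) (hmM : m <= M) :
  exists A B : {poly R}, forall p : {i01 R},
    B.[p%:num] != 0 /\
    time_constant (two_point p m M) = (A.[p%:num] / B.[p%:num])%:E.
Proof.
have [A [B AB]] := is_time_constant_two_valued hm hmM.
have supp (p : {i01 R}) : two_point p m M [set m%:E; M%:E] = 1%E.
  rewrite two_point_split !mem_set ?subrK//=; by [left|right].
have atom (p : {i01 R}) :
    two_point p m M [set M%:E] = (if m == M then 1 else p%:num)%:E.
  rewrite two_point_split (mem_set (erefl : [set M%:E] M%:E)).
  case: (eqVneq m M) => [->|mM].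
    by rewrite mem_set ?subrK.
  by rewrite memNset ?add0r// => -[] e; rewrite e eqxx in mM.
(* If [m = M], the two atoms merge into one of mass 1 whatever [p] is, so the general fraction is
   evaluated at 1 and taken as constant. *)
have [mM|mM] := eqVneq m M.
  have [B1 h] := AB 1 ltac:(by rewrite ler01 lexx).
  exists (A.[1])%:P, (B.[1])%:P => p; rewrite !hornerC; split=> //.
  apply: time_constantE; apply: h; last exact: supp.
  by apply: etrans (atom p) _; rewrite mM eqxx.
exists A, B => p.
have [Bp h] := AB p%:num ltac:(by apply/andP; split).
split=> //; apply: time_constantE; apply: h; last exact: supp.
by apply: etrans (atom p) _; rewrite (negbTE mM).
Qed.
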